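(* Let $\Delta = (Q,\Gamma,\delta)$ be a probabilistic pushdown automaton (pPDA) and let $(x_{pZ})_{pZ\in Q\times\Gamma}$ be $[0,\infty]$-valued variables. The expected runtimes $x_{pZ} = \mathsf{ert}[pZ]$, $pZ \in Q\times\Gamma$, constitute the (component-wise) least solution in $[0,\infty]^{Q\times\Gamma}$ of the linear equation system $$x_{pZ} = 1 + \sum_{pZ\xrightarrow{a}rY} a\, x_{rY} + \sum_{pZ\xrightarrow{a}rYX} a\Big(x_{rY} + \sum_{t\in Q}[rY|t]\, x_{tX}\Big)\qquad (pZ\in Q\times\Gamma).$$
   Context: A pPDA $\Delta=(Q,\Gamma,\delta)$ has a finite state set $Q$, a finite stack alphabet $\Gamma$, and a finite weighted transition relation $\delta \subseteq Q\times\Gamma\times\mathbb{Q}_{\ge 0}\times Q\times\Gamma^{\le 2}$ ($\Gamma^{\le 2}$: words of length at most 2), where for each $(p,Z,q,\alpha)$ there is at most one $a$ with $(p,Z,a,q,\alpha)\in\delta$; such a transition is written $pZ \xrightarrow{a} q\alpha$. For all $pZ\in Q\times\Gamma$ one requires $\sum_{pZ\xrightarrow{a}q\alpha} a = 1$. Configurations are elements $p\gamma$ of $Q\times\Gamma^*$; each transition $pZ\xrightarrow{a}q\alpha$ and $\beta\in\Gamma^*$ yields a step $pZ\beta \to q\alpha\beta$ of probability $a$; configurations $p\varepsilon$ with empty stack have no outgoing steps. The probability of a finite path of configurations is the product of its step probabilities. For $p,q\in Q$, $Z\in\Gamma$: $[pZ|q]$ is the sum of the probabilities of all finite paths from $pZ$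 to $q\varepsilon$. The expected runtime is $\mathsf{ert}[pZ] = \big(\sum_{k\ge 0} T^k(\mathbf{1}-\chi(F))\big)_{pZ}\in[0,\infty]$, where $T$ is the matrix of step probabilities indexed by configurations, $F=Q\times\{\varepsilon\}$ and $\chi(F)$ is the $0/1$ indicator vector of $F$; equivalently, the sum of the probabilities of all finite paths (of any length $\ge 0$) starting in $pZ$ that visit only configurations with non-empty stack. In $[0,\infty]$, $0\cdot\infty=0$. *)

(* Defs.v *)
From HB Require Import structures.
From mathcomp Require Import all_boot all_order all_algebra.
From mathcomp Require Import all_classical all_reals all_analysis.

Set Implicit Arguments.
Unset Strict Implicit.
Unset Printing Implicit Defensive.

Import Order.TTheory GRing.Theory Num.Theory.
Local Open Scope ring_scope.

(* delta p Z q alpha = Some a encodes the transition pZ -a-> q alpha, i.e.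
   (p, Z, a, q, alpha) \in delta, and None the absence of such a transition.
   As an option-valued function on a finite domain, delta is a finite relation
   with at most one weight a per (p, Z, q, alpha); transitions of weight
   Some 0 are allowed. *)
Record pPDA (Q Gamma : finType) := PPDA {
  delta : Q -> Gamma -> Q -> 2.-bseq Gamma -> option rat ;
  delta_ge0 : forall p Z q alpha a, delta p Z q alpha = Some a -> 0 <= a ;
  delta_sum1 : forall p Z,
    \sum_(q : Q) \sum_(alpha : 2.-bseq Gamma) odflt 0 (delta p Z q alpha) = 1
}.

Definition weight (Q Gamma : finType) (D : pPDA Q Gamma)
    (p : Q) (Z : Gamma) (q : Q) (alpha : 2.-bseq Gamma) : rat :=
  odflt 0 (delta D p Z q alpha).

Definition word1 (Gamma : finType) (Y : Gamma) : 2.-bseq Gamma :=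
  @Bseq 2 Gamma [:: Y] isT.

Definition word2 (Gamma : finType) (Y X : Gamma) : 2.-bseq Gamma :=
  @Bseq 2 Gamma [:: Y; X] isT.

(* A configuration p gamma is the pair (p, gamma), the top of the stack being
   the head of gamma. *)
Definition is_step (Q Gamma : finType) (D : pPDA Q Gamma) :
    rel (Q * seq Gamma) := fun c c' =>
  if c is (p, Z :: beta) then
    [exists alpha : 2.-bseq Gamma,
      (delta D p Z c'.1 alpha != None) && (c'.2 == alpha ++ beta)]
  else false.

(* The entries of the matrix T. At most one alpha satisfies the condition of
   the sum: c'.2 and beta determine it. *)
Definition step_prob (Q Gamma : finType) (D : pPDA Q Gamma)
    (c c' : Q * seq Gamma) : rat :=
  if c is (p, Z :: beta) then
    \sum_(alpha : 2.-bseq Gamma | c'.2 == alpha ++ beta) weight D p Z c'.1 alpha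
  else 0.

(* The path c, s_0, s_1, ... is represented by its head c and its tail s, as
   in the library's path predicate. *)
Definition path_prob (Q Gamma : finType) (D : pPDA Q Gamma)
    (c : Q * seq Gamma) (s : seq (Q * seq Gamma)) : rat :=
  \prod_(a <- pairmap (step_prob D) c s) a.

Local Open Scope classical_set_scope.
Local Open Scope ereal_scope.

Section Extended.
Variables (R : realType) (Q Gamma : finType) (D : pPDA Q Gamma).

Definition term_prob (p : Q) (Z : Gamma) (q : Q) : \bar R :=
  \esum_(s in [set s : seq (Q * seq Gamma) |
                path (is_step D) (p, [:: Z]) s
                /\ last (p, [:: Z]) s = (q, [::])])
    (ratr (path_prob D (p, [:: Z]) s))%:E.

Definition empty_configs : set (Q * seq Gamma) := [set c | c.2 = [::]].

Definition step_op (v : Q * seq Gamma -> \bar R) (c : Q * seq Gamma) : \bar R :=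
  \esum_(c' in [set: Q * seq Gamma]) (ratr (step_prob D c c'))%:E * v c'.

Definition ert (p : Q) (Z : Gamma) : \bar R :=
  \sum_(0 <= k <oo)
    iter k step_op (fun c => (1 - \1_empty_configs c)%:E) (p, [:: Z]).

Definition ert_rhs (x : Q -> Gamma -> \bar R) (p : Q) (Z : Gamma) : \bar R :=
  1 + \sum_(r : Q) \sum_(Y : Gamma)
        (ratr (weight D p Z r (word1 Y)))%:E * x r Y
    + \sum_(r : Q) \sum_(Y : Gamma) \sum_(X : Gamma)
        (ratr (weight D p Z r (word2 Y X)))%:E
        * (x r Y + \sum_(t : Q) term_prob r Y t * x t X).

Definition ert_solution (x : Q -> Gamma -> \bar R) : Prop :=
  (forall p Z, 0 <= x p Z) /\ (forall p Z, x p Z = ert_rhs x p Z).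

End Extended.

(* Main.v *)
(* Write T for the matrix of step probabilities and, for f >= 0 on
   configurations, green f = \sum_k T^k f; it is the least nonnegative g with
   g >= f + T g. Both ert and term_prob are values of green, for f the indicator
   of nonempty stacks and of (t, []) respectively. Running p (gamma ++ beta)
   only until beta is exposed gives superadditivity of green along
   concatenation of stacks. Given y with ert_rhs y <= y, extend y to all
   configurations by
     V (p, []) = 0,  V (p, Z gamma) = y p Z + \sum_t [pZ|t] V (t, gamma);
   superadditivity of the termination probabilities yields
   nonempty + T V <= V, whence green nonempty <= V and ert <= y.
   Superadditivity of the runtime gives V <= green nonempty when y = ert, so
   ert_rhs ert <= ert, and the previous argument applied to y = ert turns this
   inequality into an equality. *)
Require Import Defs.
From HB Require Import structures.
From mathcomp Require Import all_boot all_order all_algebra.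
From mathcomp Require Import all_classical all_reals all_analysis.

Set Implicit Arguments.
Unset Strict Implicit.
Unset Printing Implicit Defensive.

Import Order.TTheory GRing.Theory Num.Theory.

Local Open Scope ring_scope.
Local Open Scope classical_set_scope.
Local Open Scope ereal_scope.

(** * Sums of extended nonnegative reals, and sums over short words *)

Lemma esum_pred1 (R : realType) (T : choiceType) (x : T) (a : \bar R) :
  0 <= a -> \esum_(y in [set: T]) (if y == x then a else 0) = a.
Proof.
move=> a0; rewrite -[RHS](@esum_set1 _ _ x (fun=> a))// [RHS]esum_mkcond.
apply: eq_esum => y _; congr (if _ then _ else _).
by apply/eqP/idP => [->|/set_mem]; first exact/mem_set.
Qed.

(** For [a = +oo], the convention 0 * oo = 0 settles the zero series, and a single positive term
    makes both sides infinite. *)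
Lemma ge0_nneseriesZl (R : realType) (f : nat -> \bar R) (a : \bar R) :
  0 <= a -> (forall k, 0 <= f k) ->
  \sum_(0 <= k <oo) (a * f k) = a * \sum_(0 <= k <oo) f k.
Proof.
case: a => [a| |//] a0 f0; first by rewrite nneseriesZl.
have [f_eq0|] := pselect (forall k, f k = 0).
  by rewrite !eseries0 ?mule0// => k _ _; rewrite f_eq0 ?mule0.
move=> /existsNP[k /eqP fk_neq0].
have fk_gt0 : 0 < f k by rewrite lt_def fk_neq0 f0.
rewrite [LHS](@nneseries_pinfty _ _ _ k)//=; last 2 first.
- by move=> n _; rewrite mule_ge0.
- by rewrite gt0_mulye.
rewrite gt0_mulye//; apply: lt_le_trans fk_gt0 _.
rewrite (nneseriesD1 (n := k))// leeDl//.
exact: nneseries_ge0.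
Qed.

Lemma ge0_esumZl (R : realType) (T : choiceType) (I : set T) (r : R)
    (a : T -> \bar R) : (0 <= r)%R -> (forall i, 0 <= a i) ->
  \esum_(i in I) (r%:E * a i) = r%:E * \esum_(i in I) a i.
Proof.
move=> r0 a0; rewrite /esum -ereal_supZl//; last first.
  by apply/set0P; exists 0; exists set0;
    [exact: fsets_set0|rewrite fsbig_set0].
rewrite image_comp; congr ereal_sup; apply: eq_imagel => X _ /=.
by rewrite ge0_mule_fsumr.
Qed.

(** Words of length at most two are encoded as [unit + Gamma + Gamma * Gamma], over which sums split
    by length. *)
Lemma sum_bseq2 (R : realType) (Gamma : finType)
    (F : 2.-bseq Gamma -> \bar R) :
  \sum_(alpha : 2.-bseq Gamma) F alpha =
  F [bseq] + \sum_(Y : Gamma) F (word1 Y)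
  + \sum_(Y : Gamma) \sum_(X : Gamma) F (word2 Y X).
Proof.
pose h (u : unit + Gamma + Gamma * Gamma) : 2.-bseq Gamma :=
  match u with
  | inl (inl _) => [bseq]
  | inl (inr Y) => word1 Y
  | inr YX => word2 YX.1 YX.2
  end.
pose h' (alpha : 2.-bseq Gamma) : unit + Gamma + Gamma * Gamma :=
  match (alpha : seq Gamma) with
  | [::] => inl (inl tt)
  | [:: Y] => inl (inr Y)
  | Y :: X :: _ => inr (Y, X)
  end.
have h'K : cancel h' h.
  by case=> -[|Y [|X [|? ?]]] // s2; apply: val_inj.
have hK : cancel h h' by case=> [[[]|Y]|[Y X]].
rewrite (reindex h); last by exists h' => u _; [exact: hK|exact: h'K].
rewrite !big_sumType/= (big_pred1 tt); last by case.
by rewrite pair_big.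
Qed.

Section Greens.
Variables (R : realType) (Q Gamma : finType) (D : pPDA Q Gamma).
Implicit Types (f g v : Q * seq Gamma -> \bar R) (c : Q * seq Gamma).

(** * The step operator: monotonicity and linearity *)

Lemma weight_ge0 p Z q alpha : (0 <= weight D p Z q alpha)%R.
Proof.
by rewrite /weight; case: delta (@delta_ge0 _ _ D p Z q alpha) => //= a; apply.
Qed.

Lemma step_prob_ge0 c c' : (0 <= step_prob D c c')%R.
Proof.
by case: c => p [|Z beta] //=; apply: sumr_ge0 => alpha _; exact: weight_ge0.
Qed.

Lemma EFin_ratr_ge0 (a : rat) : (0 <= a)%R -> 0 <= (ratr a : R)%:E.
Proof. by rewrite lee_fin ler0q. Qed.

Lemma step_op_nil v p : step_op D v (p, [::]) = 0.
Proof. by rewrite /step_op esum1// => c' _ /=; rewrite rmorph0 mul0e. Qed.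

(** The finite sum over transitions is what lets [step_op] commute with infinite scalars and with
    series below. *)
Lemma step_op_cons v p Z beta : (forall c, 0 <= v c) ->
  step_op D v (p, Z :: beta) =
  \sum_(q : Q) \sum_(alpha : 2.-bseq Gamma)
    (ratr (weight D p Z q alpha))%:E * v (q, alpha ++ beta).
Proof.
move=> v0.
have w0 q (alpha : 2.-bseq Gamma) :
    0 <= (ratr (weight D p Z q alpha) : R)%:E * v (q, alpha ++ beta).
  by rewrite mule_ge0// EFin_ratr_ge0// weight_ge0.
rewrite /step_op.
under eq_esum => c' _.
  (* Each transition is attached to its unique target, so that the sum over [c'] can be exchanged
     with the finite sums and collapses by [esum_pred1]. *)
  rewrite (_ : _ * _ = \sum_(q : Q) \sum_(alpha : 2.-bseq Gamma)
    if c' == (q, alpha ++ beta) then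
      (ratr (weight D p Z q alpha))%:E * v (q, alpha ++ beta) else 0); last first.
    rewrite /= rmorph_sum -sumEFin ge0_sume_distrl; last first.
      by move=> alpha _; rewrite EFin_ratr_ge0// weight_ge0.
    rewrite (bigD1 c'.1)//= [X in _ = _ + X]big1 ?adde0; last first.
      move=> q qc'; rewrite big1// => alpha _.
      by case: eqP => // c'E; rewrite c'E eqxx in qc'.
    rewrite big_mkcond; apply: eq_bigr => alpha _.
    by case: c' => q gamma; rewrite xpair_eqE eqxx/=; case: eqP => // ->.
  over.
rewrite esum_sum; last first.
  by move=> c' q _ _; apply: sume_ge0 => alpha _; case: ifP.
apply: eq_bigr => q _; rewrite esum_sum; last by move=> c' alpha _ _; case: ifP.
by apply: eq_bigr => alpha _; rewrite esum_pred1.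
Qed.

Lemma step_op_ge0 v c : (forall c, 0 <= v c) -> 0 <= step_op D v c.
Proof.
move=> v0; apply: esum_ge0 => c' _.
by rewrite mule_ge0// EFin_ratr_ge0// step_prob_ge0.
Qed.

Lemma le_step_op v w c : (forall c, v c <= w c) ->
  step_op D v c <= step_op D w c.
Proof.
move=> vw; apply: le_esum => c' _.
by rewrite lee_wpmul2l// EFin_ratr_ge0// step_prob_ge0.
Qed.

Lemma step_opD v w c : (forall c, 0 <= v c) -> (forall c, 0 <= w c) ->
  step_op D (fun c => v c + w c) c = step_op D v c + step_op D w c.
Proof.
move=> v0 w0; have p0 c' := EFin_ratr_ge0 (step_prob_ge0 c c').
rewrite /step_op -esumD//; do ?by move=> *; rewrite mule_ge0.
by apply: eq_esum => c' _; rewrite ge0_muleDr.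
Qed.

(** The scalar may be infinite, whereas [ge0_esumZl] takes a real factor; hence the passage to
    finite sums. *)
Lemma step_opZ a v c : 0 <= a -> (forall c, 0 <= v c) ->
  step_op D (fun c => a * v c) c = a * step_op D v c.
Proof.
move=> a0 v0; case: c => p [|Z beta]; first by rewrite !step_op_nil mule0.
have w0 q (alpha : 2.-bseq Gamma) :
    0 <= (ratr (weight D p Z q alpha) : R)%:E * v (q, alpha ++ beta).
  by rewrite mule_ge0// EFin_ratr_ge0// weight_ge0.
rewrite !step_op_cons//; last by move=> c; rewrite mule_ge0.
rewrite ge0_sume_distrr; last by move=> *; rewrite sume_ge0.
apply: eq_bigr => q _; rewrite ge0_sume_distrr//.
by apply: eq_bigr => alpha _; rewrite muleCA.
Qed.

Lemma step_op_sum (I : choiceType) (r : seq I) (F : I -> Q * seq Gamma -> \bar R) c :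
  (forall i c, 0 <= F i c) ->
  step_op D (fun c => \sum_(i <- r) F i c) c = \sum_(i <- r) step_op D (F i) c.
Proof.
move=> F0; rewrite /step_op -esum_sum; last first.
  by move=> *; rewrite mule_ge0// EFin_ratr_ge0// step_prob_ge0.
by apply: eq_esum => c' _; rewrite ge0_sume_distrr.
Qed.

Lemma step_op_eseries (F : nat -> Q * seq Gamma -> \bar R) c :
  (forall k c, 0 <= F k c) ->
  step_op D (fun c => \sum_(0 <= k <oo) F k c) c =
  \sum_(0 <= k <oo) step_op D (F k) c.
Proof.
move=> F0; case: c => p [|Z beta].
  by rewrite step_op_nil eseries0// => k _ _; rewrite step_op_nil.
have w0 k q (alpha : 2.-bseq Gamma) :
    0 <= (ratr (weight D p Z q alpha) : R)%:E * F k (q, alpha ++ beta).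
  by rewrite mule_ge0// EFin_ratr_ge0// weight_ge0.
rewrite step_op_cons; last by move=> c; exact: nneseries_ge0.
under [RHS]eq_eseriesr do rewrite step_op_cons//.
rewrite nneseries_sum; last by move=> *; rewrite sume_ge0.
apply: eq_bigr => q _; rewrite nneseries_sum//.
by apply: eq_bigr => alpha _; rewrite nneseriesZl.
Qed.

(** * The Green operator: fixed point, leastness, linearity *)

Lemma iter_step_op_ge0 f k c : (forall c, 0 <= f c) ->
  0 <= iter k (step_op D) f c.
Proof.
by move=> f0; elim: k c => [//|k IH] c; rewrite iterS; exact: step_op_ge0.
Qed.

(* Named after the Green operator \sum_k T^k of a Markov chain. *)
Definition green f c : \bar R := \sum_(0 <= k <oo) iter k (step_op D) f c.

Lemma green_ge0 f c : (forall c, 0 <= f c) -> 0 <= green f c.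
Proof. by move=> f0; apply: nneseries_ge0 => *; exact: iter_step_op_ge0. Qed.

Lemma green_fix f c : (forall c, 0 <= f c) ->
  green f c = f c + step_op D (green f) c.
Proof.
move=> f0; have it0 k c' := iter_step_op_ge0 k c' f0.
rewrite {1}/green nneseries_recl//= -nneseries_addn//; congr (_ + _).
rewrite step_op_eseries//; apply: eq_eseriesr => k _.
by rewrite addn1.
Qed.

(** The partial sums satisfy S_(n+1) = f + T S_n, so S_n <= g propagates by induction on n. *)
Lemma green_least f g c : (forall c, 0 <= f c) -> (forall c, 0 <= g c) ->
  (forall c, f c + step_op D g c <= g c) -> green f c <= g c.
Proof.
move=> f0 g0 fg; have it0 k c' := iter_step_op_ge0 k c' f0.
apply: lime_le; first exact: is_cvg_nneseries.
apply: nearW => n; elim: n c => [|n IH] c; first by rewrite big_geq.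
rewrite big_nat_recl//=; apply: le_trans (fg c); rewrite leeD2l//.
by rewrite -step_op_sum//; exact: le_step_op.
Qed.

Lemma greenD f g c : (forall c, 0 <= f c) -> (forall c, 0 <= g c) ->
  green (fun c => f c + g c) c = green f c + green g c.
Proof.
move=> f0 g0; rewrite /green -nneseriesD; do ?by move=> *; exact: iter_step_op_ge0.
apply: eq_eseriesr => k _; elim: k c => [//|k IH] c.
rewrite !iterS -step_opD//; do ?by move=> *; exact: iter_step_op_ge0.
by congr (step_op D _ c); apply/funext => c'; exact: IH.
Qed.

Lemma greenZ a f c : 0 <= a -> (forall c, 0 <= f c) ->
  green (fun c => a * f c) c = a * green f c.
Proof.
move=> a0 f0; rewrite /green -ge0_nneseriesZl//; last first.
  by move=> *; exact: iter_step_op_ge0.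
apply: eq_eseriesr => k _; elim: k c => [//|k IH] c.
rewrite !iterS -step_opZ//; do ?by move=> *; exact: iter_step_op_ge0.
by congr (step_op D _ c); apply/funext => c'; exact: IH.
Qed.

Lemma green_sum (I : choiceType) (r : seq I) (F : I -> Q * seq Gamma -> \bar R) c :
  (forall i c, 0 <= F i c) ->
  green (fun c => \sum_(i <- r) F i c) c = \sum_(i <- r) green (F i) c.
Proof.
move=> F0; rewrite /green -nneseries_sum; last first.
  by move=> *; exact: iter_step_op_ge0.
apply: eq_eseriesr => k _; elim: k c => [//|k IH] c.
rewrite !iterS -step_op_sum//; do ?by move=> *; exact: iter_step_op_ge0.
by congr (step_op D _ c); apply/funext => c'; exact: IH.
Qed.

(** * Path expansion of the iterates, and termination probabilities *)

Lemma path_prob_cons c c' s :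
  path_prob D c (c' :: s) = (step_prob D c c' * path_prob D c' s)%R.
Proof. by rewrite /path_prob /= big_cons. Qed.

Lemma path_prob_ge0 c s : (0 <= path_prob D c s)%R.
Proof.
elim: s c => [|c' s IH] c; first by rewrite /path_prob big_nil.
by rewrite path_prob_cons mulr_ge0// step_prob_ge0.
Qed.

Lemma step_prob_eq0 c c' : ~~ is_step D c c' -> step_prob D c c' = 0%R.
Proof.
case: c => p [//|Z beta] /existsPn no_step; apply: big1 => alpha c'E.
have := no_step alpha; rewrite c'E andbT negbK => /eqP.
by rewrite /weight => ->.
Qed.

Lemma path_prob_eq0 c s : ~~ path (is_step D) c s -> path_prob D c s = 0%R.
Proof.
elim: s c => [//|c' s IH] c /=; rewrite path_prob_cons negb_and.
by case/orP => [/step_prob_eq0|/IH] ->; rewrite ?mul0r ?mulr0.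
Qed.

(** Induction on the first step. Sequences that are not paths may be included, since their
    [path_prob] is 0. *)
Lemma iter_step_op_paths f k c : (forall c, 0 <= f c) ->
  iter k (step_op D) f c =
  \esum_(s in [set s | size s = k])
    (ratr (path_prob D c s))%:E * f (last c s).
Proof.
move=> f0.
have g0 c' s : 0 <= (ratr (path_prob D c' s) : R)%:E * f (last c' s).
  by rewrite mule_ge0// EFin_ratr_ge0// path_prob_ge0.
elim: k c => [|k IH] c.
  rewrite (_ : [set s | size s = 0%N] = [set [::]]).
    by rewrite esum_set1// /path_prob big_nil rmorph1 mul1e.
  by apply/seteqP; split => s /= => [/size0nil|->].
rewrite iterS /step_op.
under eq_esum => c' _.
  rewrite IH -ge0_esumZl//; last by rewrite ler0q step_prob_ge0.
  over.
rewrite esum_esum; last first.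
  by move=> c' s _ _; rewrite mule_ge0// EFin_ratr_ge0// step_prob_ge0.
rewrite [RHS](@reindex_esum _ _ _ ([set: _] `*`` fun=> [set s | size s = k]) _
  (fun c's => c's.1 :: c's.2)).
  apply: eq_esum => -[c' s] _ /=.
  by rewrite path_prob_cons rmorphM EFinM muleA.
split.
- by move=> [c' s] [_ /= ->].
- by move=> [c1 s1] [c2 s2] _ _ /= [-> ->].
- by move=> [//|c' s] /= [sk]; exists (c', s).
Qed.

Definition exit_at (t : Q) c : \bar R := if c == (t, [::]) then 1 else 0.

Lemma exit_at_ge0 t c : 0 <= exit_at t c.
Proof. by rewrite /exit_at; case: ifP. Qed.
#[local] Hint Resolve exit_at_ge0 : core.

(** Grouping sequences by length turns the series into one sum; [exit_at t] selects the right end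
    point, and [path_prob] vanishes on non-paths. *)
Lemma term_probE p Z t :
  term_prob R D p Z t = green (exit_at t) (p, [:: Z]).
Proof.
rewrite /green; under eq_eseriesr do rewrite iter_step_op_paths//.
rewrite -nneseries_sum_bigcup; last 2 first.
- by move=> i j _ _ [s [/= <- <-]].
- by move=> s; rewrite mule_ge0// EFin_ratr_ge0// path_prob_ge0.
rewrite (_ : \bigcup_k _ = [set: _]); last first.
  by apply/seteqP; split => // s _; exists (size s).
rewrite /term_prob esum_mkcond; apply: eq_esum => s _.
rewrite /exit_at; case: ifPn => [/set_mem[_ ->]|/negP s_notin].
  by rewrite eqxx mule1.
case: eqP => [sE|_]; last by rewrite mule0.
rewrite path_prob_eq0 ?rmorph0 ?mul0e//; apply/negP => s_path.
by apply: s_notin; exact/mem_set.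
Qed.

Lemma term_prob_ge0 p Z t : 0 <= term_prob R D p Z t.
Proof. by rewrite term_probE; exact: green_ge0. Qed.

(** * Superadditivity along concatenation of stacks *)

Lemma green_nil f p : (forall c, 0 <= f c) -> green f (p, [::]) = f (p, [::]).
Proof. by move=> f0; rewrite green_fix// step_op_nil adde0. Qed.

Lemma sum_exit_at (F : Q -> \bar R) p :
  \sum_(u : Q) exit_at u (p, [::]) * F u = F p.
Proof.
rewrite (bigD1 p)//= /exit_at eqxx mul1e big1 ?adde0// => u up.
by rewrite xpair_eqE eq_sym (negbTE up) mul0e.
Qed.

(* The left-hand side runs the stack c.2 alone and, once it is empty, collects
   at once everything that the continuation on beta would contribute. *)
Lemma green_stop f beta c : (forall c, 0 <= f c) ->
  green (fun c => if c.2 is [::] then green f (c.1, beta)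
                  else f (c.1, c.2 ++ beta)) c <=
  green f (c.1, c.2 ++ beta).
Proof.
move=> f0; apply: (@green_least _ (fun c => green f (c.1, c.2 ++ beta))).
- by move=> [q [|Z gamma]] //=; exact: green_ge0.
- by move=> c'; exact: green_ge0.
move=> [q [|Z gamma]] /=; first by rewrite step_op_nil adde0.
rewrite [leRHS]green_fix// leeD2l// !step_op_cons; do ?by move=> *; exact: green_ge0.
by apply: lee_sum => r _; apply: lee_sum => alpha _; rewrite /= catA.
Qed.

(** The reward in [green_stop] splits into [f] before [gamma] is used up and [green f (u, beta)] for
    the state [u] reached then; linearity of [green] separates the two. *)
Lemma green_cat f beta p gamma : (forall c, 0 <= f c) ->
  (forall q Z gamma', f (q, Z :: gamma' ++ beta) = f (q, Z :: gamma')) ->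
  green (fun c => if c.2 is [::] then 0 else f c) (p, gamma)
  + \sum_(u : Q) green (exit_at u) (p, gamma) * green f (u, beta)
  <= green f (p, gamma ++ beta).
Proof.
move=> f0 f_cat; have Gf0 u : 0 <= green f (u, beta) by exact: green_ge0.
under eq_bigr do rewrite muleC -greenZ//.
rewrite -green_sum; last by move=> *; rewrite mule_ge0.
rewrite -greenD; last 2 first.
- by case=> q [|Z gamma'] /=.
- by move=> c; apply: sume_ge0 => u _; rewrite mule_ge0.
apply: le_trans (green_stop beta (p, gamma) f0).
rewrite le_eqVlt; apply/orP; left; apply/eqP; congr (green _ _).
(* At an empty stack only the exit term of the current state survives; elsewhere all exit terms
   vanish and [f_cat] removes [beta]. *)
apply/funext => -[q [|Z gamma']] /=.
  rewrite add0e -(sum_exit_at (fun u => green f (u, beta)) q).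
  by apply: eq_bigr => u _; rewrite muleC.
by rewrite f_cat big1 ?adde0// => u _; rewrite /exit_at xpair_eqE andbF mule0.
Qed.

(** Emptying [gamma] into state [u] and then [beta] into [t] is one way of emptying [gamma ++ beta]
    into [t]. *)
Lemma green_exit_cat t p gamma beta :
  \sum_(u : Q) green (exit_at u) (p, gamma) * green (exit_at t) (u, beta)
  <= green (exit_at t) (p, gamma ++ beta).
Proof.
apply: le_trans (green_cat p gamma (exit_at_ge0 t) _) => [|q Z gamma'].
  by rewrite leeDr// green_ge0// => -[q [|Z gamma']] /=.
by rewrite /exit_at !xpair_eqE !andbF.
Qed.

(** Spelled as the initial vector in [ert], so that [ertE] holds by conversion. *)
Definition nonempty c : \bar R := (1 - \1_(@empty_configs Q Gamma) c)%:E.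

Lemma nonempty_nil p : nonempty (p, [::]) = 0.
Proof. by rewrite /nonempty indicE mem_set//= subrr. Qed.

Lemma nonempty_cons p Z gamma : nonempty (p, Z :: gamma) = 1.
Proof. by rewrite /nonempty indicE memNset//= subr0. Qed.

Lemma nonempty_ge0 c : 0 <= nonempty c.
Proof. by case: c => p [|Z gamma]; rewrite ?nonempty_nil ?nonempty_cons. Qed.
#[local] Hint Resolve nonempty_ge0 : core.

Lemma ertE p Z : ert R D p Z = green nonempty (p, [:: Z]).
Proof. by []. Qed.

Lemma ert_ge0 p Z : 0 <= ert R D p Z.
Proof. by rewrite ertE green_ge0. Qed.

Lemma green_nonempty_cat p gamma beta :
  green nonempty (p, gamma)
  + \sum_(u : Q) green (exit_at u) (p, gamma) * green nonempty (u, beta)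
  <= green nonempty (p, gamma ++ beta).
Proof.
apply: le_trans (green_cat p gamma nonempty_ge0 _) => [|q Z gamma'].
  rewrite leeD2r// le_eqVlt; apply/orP; left; apply/eqP; congr (green _ _).
  by apply/funext => -[q [|Z gamma']] //=; rewrite nonempty_nil.
by rewrite !nonempty_cons.
Qed.

(** * The extension [V] of a candidate solution to all stacks *)

Fixpoint stack_value (y : Q -> Gamma -> \bar R) p gamma : \bar R :=
  if gamma is Z :: gamma' then
    y p Z + \sum_(t : Q) term_prob R D p Z t * stack_value y t gamma'
  else 0.

Section StackValue.
Variable y : Q -> Gamma -> \bar R.
Hypothesis y_ge0 : forall p Z, 0 <= y p Z.

Lemma stack_value_ge0 p gamma : 0 <= stack_value y p gamma.
Proof.
elim: gamma p => [//|Z gamma IH] p /=; rewrite adde_ge0// sume_ge0// => t _.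
by rewrite mule_ge0// term_prob_ge0.
Qed.
#[local] Hint Resolve stack_value_ge0 : core.

Lemma stack_value1 p Z : stack_value y p [:: Z] = y p Z.
Proof. by rewrite /= big1 ?adde0// => t _; rewrite mule0. Qed.

(** By [sum_bseq2]: on successor words of length 0, 1 and 2, [V] is 0, [y r Y] and the bracket of
    the equation. *)
Lemma ert_rhsE p Z :
  ert_rhs D y p Z =
  1 + step_op D (fun c => stack_value y c.1 c.2) (p, [:: Z]).
Proof.
rewrite /ert_rhs step_op_cons// -addeA; congr (_ + _).
rewrite -big_split; apply: eq_bigr => q _ /=.
rewrite sum_bseq2/= mule0 add0e; congr (_ + _).
  by apply: eq_bigr => Y _; rewrite big1 ?adde0// => t _; rewrite mule0.
apply: eq_bigr => Y _; apply: eq_bigr => X _; congr (_ * (_ + _)).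
apply: eq_bigr => t _; congr (_ * _).
by rewrite big1 ?adde0// => u _; rewrite mule0.
Qed.

(** Induction on [gamma]: exiting from [Z] and then from [gamma] is dominated by exiting from
    [Z :: gamma], by [green_exit_cat]. *)
Lemma stack_value_cat p gamma beta :
  stack_value y p (gamma ++ beta) <=
  stack_value y p gamma
  + \sum_(t : Q) green (exit_at t) (p, gamma) * stack_value y t beta.
Proof.
have G0 t c : 0 <= green (exit_at t) c by exact: green_ge0.
have GV0 t c : 0 <= green (exit_at t) c * stack_value y t beta.
  by rewrite mule_ge0.
have tp0 := term_prob_ge0.
elim: gamma p => [|Z gamma IH] p /=.
  under eq_bigr do rewrite green_nil//.
  by rewrite sum_exit_at add0e.
rewrite -addeA leeD2l//.
apply: (@le_trans _ _ (\sum_(u : Q) term_prob R D p Z u *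
    (stack_value y u gamma
     + \sum_(t : Q) green (exit_at t) (u, gamma) * stack_value y t beta))).
  by apply: lee_sum => u _; rewrite lee_wpmul2l.
under [leLHS]eq_bigr do rewrite ge0_muleDr ?sume_ge0//.
rewrite big_split/= leeD2l//.
under eq_bigr do rewrite ge0_sume_distrr//.
rewrite exchange_big/=; apply: lee_sum => t _.
under eq_bigr do rewrite muleA term_probE.
rewrite -ge0_sume_distrl; last by move=> u _; rewrite mule_ge0.
by rewrite lee_wpmul2r// (green_exit_cat t p [:: Z] gamma).
Qed.

Hypothesis y_super : forall p Z, ert_rhs D y p Z <= y p Z.

Lemma green_nonempty_le_stack_value p gamma :
  green nonempty (p, gamma) <= stack_value y p gamma.
Proof.
have G0 t c : 0 <= green (exit_at t) c by exact: green_ge0.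
have GV0 beta t c : 0 <= green (exit_at t) c * stack_value y t beta.
  by rewrite mule_ge0.
apply: (@green_least _ (fun c => stack_value y c.1 c.2)) => // -[q [|Z beta]].
  by rewrite step_op_nil nonempty_nil adde0.
rewrite nonempty_cons /=.
apply: (@le_trans _ _ (ert_rhs D y q Z
    + \sum_(t : Q) term_prob R D q Z t * stack_value y t beta)); last first.
  by rewrite leeD2r.
rewrite ert_rhsE -addeA leeD2l//.
(* Unfolding the first step of each [[qZ|t]] makes the right-hand side a single [step_op] at the
   stack [[:: Z]]; the two sides are then compared transition by transition through
   [stack_value_cat]. *)
under eq_bigr => t _.
  rewrite term_probE green_fix// {1}/exit_at xpair_eqE andbF add0e muleC.
  rewrite -step_opZ//; over.
rewrite -step_op_sum; last by move=> *; rewrite mule_ge0.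
rewrite -step_opD//; last by move=> c; rewrite sume_ge0// => *; rewrite mule_ge0.
rewrite !step_op_cons//; last first.
  by move=> c; rewrite adde_ge0// sume_ge0// => *; rewrite mule_ge0.
apply: lee_sum => r _; apply: lee_sum => alpha _.
rewrite lee_wpmul2l ?EFin_ratr_ge0 ?weight_ge0//= cats0.
under eq_bigr do rewrite muleC.
exact: stack_value_cat.
Qed.

End StackValue.

(** * The expected runtime as the least solution *)

Lemma stack_value_ert_le p gamma :
  stack_value (ert R D) p gamma <= green nonempty (p, gamma).
Proof.
elim: gamma p => [|Z gamma IH] p /=; first exact: green_ge0.
apply: le_trans (green_nonempty_cat p [:: Z] gamma).
rewrite -ertE leeD2l//; apply: lee_sum => t _.
by rewrite -term_probE lee_wpmul2l// term_prob_ge0.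
Qed.

Lemma ert_rhs_ert_le p Z : ert_rhs D (ert R D) p Z <= ert R D p Z.
Proof.
rewrite ert_rhsE; last exact: ert_ge0.
rewrite [leRHS]ertE green_fix// nonempty_cons leeD2l//.
by apply: le_step_op => -[q gamma]; exact: stack_value_ert_le.
Qed.

Lemma ert_solution_ert : ert_solution D (ert R D).
Proof.
split=> [|p Z]; first exact: ert_ge0.
apply/eqP; rewrite eq_le ert_rhs_ert_le andbT.
(* For the remaining inequality both sides are unfolded to 1 plus one step, which leaves
   [green nonempty <= V] at the successors. *)
rewrite ert_rhsE; last exact: ert_ge0.
rewrite [leLHS]ertE green_fix// nonempty_cons leeD2l//.
apply: le_step_op => -[q gamma].
by apply: green_nonempty_le_stack_value; [exact: ert_ge0|exact: ert_rhs_ert_le].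
Qed.

Lemma ert_le_solution (y : Q -> Gamma -> \bar R) p Z :
  ert_solution D y -> ert R D p Z <= y p Z.
Proof.
move=> [y0 yE]; rewrite ertE -(stack_value1 y p Z).
by apply: green_nonempty_le_stack_value => // q Y; rewrite -yE.
Qed.

End Greens.

Theorem theorem7 (R : realType) (Q Gamma : finType) (D : pPDA Q Gamma) :
  ert_solution D (ert R D) /\
  (forall y : Q -> Gamma -> \bar R, ert_solution D y ->
     forall p Z, ert R D p Z <= y p Z).
Proof.
split=> [|y y_sol p Z]; first exact: ert_solution_ert.
exact: ert_le_solution.
Qed.
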